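(* Let $(M^{2n+1},\phi,\xi,\eta,g)$ be a Sasakian manifold endowed with a flat Legendrian distribution $L$, and let $Q=\phi L$ be its conjugate Legendrian distribution. If the Tanaka-Webster connection $^{\ast}\nabla$ preserves the distribution $L$ (that is, $^{\ast}\nabla_VX\in\Gamma(L)$ for all vector fields $V$ and all $X\in\Gamma(L)$), then $L$ and $Q$ are integrable and $^{\ast}\nabla$ coincides with the bi-Legendrian connection $\nabla$ associated to the almost bi-Legendrian structure $(L,Q)$.
   Context: All manifolds are smooth and connected; $\Gamma(\cdot)$ denotes smooth sections. Convention: $2d\eta(V,W)=V(\eta(W))-W(\eta(V))-\eta([V,W])$. A contact form on $M^{2n+1}$ is a 1-form $\eta$ with $\eta\wedge(d\eta)^n\neq0$ everywhere; its Reeb vector field $\xi$ is determined by $\eta(\xi)=1$, $d\eta(\xi,\cdot)=0$; $\mathcal D=\ker\eta$. A contact metric structure $(\phi,\xi,\eta,g)$ consists of a contact form $\eta$ with Reeb field $\xi$, a Riemannian metric $g$ with $g(V,\xi)=\eta(V)$ and a $(1,1)$-tensor $\phi$ with $\phi^2=-I+\eta\otimes\xi$ and $d\eta(V,W)=g(V,\phi W)$. Set $h=\frac12\mathcal L_\xi\phi$; $\hat\nabla$ is the Levi Civita connection of $g$. The manifold is Sasakian if $[\phi,\phi]+2d\eta\otimes\xi=0$, equivalently $(\hat\nabla_V\phi)W=g(V,W)\xi-\eta(W)V$ for all $V,W$. The (generalized) Tanaka-Webster connection is $^{\ast}\nabla_VW=\hat\nabla_VW+\eta(V)\phi W+\eta(W)(\phi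 V+\phi hV)+d\eta(V+hV,W)\xi$. A Legendrian distribution is an $n$-dimensional subbundle $L\subset\mathcal D$ with $d\eta(X,X')=0$ for all $X,X'\in\Gamma(L)$; it is flat if $[\xi,X]\in\Gamma(L)$ for all $X\in\Gamma(L)$. Its conjugate $Q=\phi L$ is again Legendrian and $TM=L\oplus Q\oplus\mathbb R\xi$ orthogonally. An almost bi-Legendrian structure is a pair of transversal Legendrian distributions. Subscripts denote projections onto the corresponding subbundles. Bi-Legendrian connection of a pair $(L_1,L_2)$ of transversal Legendrian distributions (so $TM=L_1\oplus L_2\oplus\mathbb R\xi$): for vector fields $V,W$ let $H(V,W)\in\Gamma(\mathcal D)$ be the unique section with $d\eta(H(V,W),Z)=V(d\eta(W,Z))-d\eta(W,[V,Z])$ for all $Z\in\Gamma(\mathcal D)$. Then for $X\in\Gamma(L_1)$, $Y\in\Gamma(L_2)$, $f\in C^\infty(M)$ and any vector field $W$, $\nabla_WX=H(W_{L_1},X)_{L_1}+[W_{L_2},X]_{L_1}+[W_{\mathbb R\xi},X]_{L_1}$, $\nabla_WY=H(W_{L_2},Y)_{L_2}+[W_{L_1},Y]_{L_2}+[W_{\mathbb R\xi},Y]_{L_2}$, $\nabla_W(f\xi)=W(f)\xi$. It preserves $L_1,L_2,\mathbb R\xi$, satisfies $\nabla d\eta=0$, $\nabla\xi=0$, and its torsion satisfies $T(X,Y)=2d\eta(X,Y)\xi$ for $X\in\Gamma(L_1),Y\in\Gamma(L_2)$ and $T(V,\xi)=[\xi,V_{L_1}]_{L_2}+[\xi,V_{L_2}]_{L_1}$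 for all $V$. *)

(* Defs.v *)
From HB Require Import structures.
From mathcomp Require Import all_boot all_order all_fingroup all_algebra.
From mathcomp Require Import all_classical all_reals all_analysis.

Set Implicit Arguments.
Unset Strict Implicit.
Unset Printing Implicit Defensive.

Import Order.TTheory GRing.Theory Num.Theory.
Import numFieldNormedType.Exports.

Local Open Scope classical_set_scope.
Local Open Scope ring_scope.

Section SmoothMaps.
Context {R : realType} {V W : normedModType R}.

(* For open A in finite dimension these are the usual classes C^k(A, W). *)
Fixpoint Ck (k : nat) (A : set V) (f : V -> W) : Prop :=
  match k with
  | 0%N => forall x, A x -> {for x, continuous f}
  | k'.+1 => (forall x, A x -> differentiable f x) /\
             (forall v, Ck k' A (fun x => 'D_v f x))
  end.

Definition smooth_on (A : set V) (f : V -> W) : Prop := forall k, Ck k A f.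

End SmoothMaps.

(* The atlas of an m-dimensional manifold is indexed by the points: [chart p]
   is a chart around p, with domain [chart_dom p] and inverse [chart_inv p].
   Values outside [chart_dom p], resp. outside its image, are irrelevant. *)
Record manifold (R : realType) (m : nat) (M : topologicalType) := Manifold {
  chart : M -> M -> 'rV[R]_m;
  chart_inv : M -> 'rV[R]_m -> M;
  chart_dom : M -> set M;
  manifold_hausdorff : hausdorff_space M;
  manifold_second_countable : @second_countable M;
  manifold_connected : connected [set: M];
  chart_dom_open : forall p, open (chart_dom p) /\ chart_dom p p;
  chart_img_open : forall p, open (chart p @` chart_dom p);
  chartK : forall p q, chart_dom p q -> chart_inv p (chart p q) = q;
  chart_continuous : forall p q, chart_dom p q -> {for q, continuous (chart p)};
  chart_inv_continuous : forall p q, chart_dom p q -> {for chart p q, continuous (chart_inv p)};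
  chart_transition_smooth : forall p q,
    smooth_on (chart p @` (chart_dom p `&` chart_dom q))
              (chart q \o chart_inv p)
}.

Section Geometry.
Context {R : realType} {m : nat} {M : topologicalType} (S : manifold R m M).

(* The tangent space at p is identified with row vectors through the
   coordinate frame at p of the chart [chart S p].  Accordingly a vector
   field is a function M -> 'rV, and a linear map between fibres acts on the right. *)
Definition vfield := M -> 'rV[R]_m.

(* The derivative V(f); f may be vector-valued. *)
Definition dird {W : normedModType R} (V : vfield) (f : M -> W) : M -> W :=
  fun p => 'D_(V p) (f \o chart_inv S p) (chart S p p).

Definition smooth_fun (f : M -> R) : Prop :=
  forall p, smooth_on (chart S p @` chart_dom S p)
                      ((f : M -> R^o) \o chart_inv S p).

(* [dird V (chart S p)] is the vector of components of V in the chart at p. *)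
Definition smooth_field (V : vfield) : Prop :=
  forall p, smooth_on (chart S p @` chart_dom S p)
                      (dird V (chart S p) \o chart_inv S p).

Definition fscale (f : M -> R) (V : vfield) : vfield := fun p => f p *: V p.

(* V(W(x)) - W(V(x)) at p, for x the coordinate functions of the chart at p *)
Definition bracket (V W : vfield) : vfield :=
  fun p => dird V (dird W (chart S p)) p - dird W (dird V (chart S p)) p.

Definition endo := M -> 'M[R]_m.
Definition app (A : endo) (V : vfield) : vfield := fun p => V p *m A p.
Definition smooth_endo (A : endo) : Prop :=
  forall V, smooth_field V -> smooth_field (app A V).

Definition form1 := M -> 'cV[R]_m.
Definition ev (eta : form1) (V : vfield) : M -> R :=
  fun p => (V p *m eta p) 0 0.
Definition smooth_form1 (eta : form1) : Prop :=
  forall V, smooth_field V -> smooth_fun (ev eta V).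

(* Exterior derivative with the factor 1/2 *)
Definition dform (eta : form1) (V W : vfield) : M -> R := fun p =>
  2^-1 * (dird V (ev eta W : M -> R^o) p - dird W (ev eta V : M -> R^o) p
          - ev eta (bracket V W) p).

Definition inner (g : endo) (V W : vfield) : M -> R :=
  fun p => (V p *m g p *m (W p)^T) 0 0.

Definition riemannian (g : endo) : Prop :=
  [/\ forall V W, smooth_field V -> smooth_field W -> smooth_fun (inner g V W),
      forall p, (g p)^T = g p
    & forall p (v : 'rV[R]_m), v != 0 -> 0 < (v *m g p *m v^T) 0 0].

Definition levi_civita (g : endo) (nabla : vfield -> vfield -> vfield) : Prop :=
  (forall V W, smooth_field V -> smooth_field W -> smooth_field (nabla V W)) /\
  (forall V V' W, smooth_field V -> smooth_field V' -> smooth_field W ->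
     nabla (V + V') W = nabla V W + nabla V' W) /\
  (forall f V W, smooth_fun f -> smooth_field V -> smooth_field W ->
     nabla (fscale f V) W = fscale f (nabla V W)) /\
  (forall V W W', smooth_field V -> smooth_field W -> smooth_field W' ->
     nabla V (W + W') = nabla V W + nabla V W') /\
  (forall f V W, smooth_fun f -> smooth_field V -> smooth_field W ->
     nabla V (fscale f W) =
     fscale (dird V (f : M -> R^o)) W + fscale f (nabla V W)) /\
  (forall V W, smooth_field V -> smooth_field W ->
     nabla V W - nabla W V = bracket V W) /\
  (forall U V W, smooth_field U -> smooth_field V -> smooth_field W ->
     dird U (inner g V W : M -> R^o) =
     (inner g (nabla U V) W + inner g V (nabla U W) : M -> R)).

(* A distribution, given at p by the row space of [L p] *)
Definition plane_field := M -> 'M[R]_m.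

Definition sections (L : plane_field) (X : vfield) : Prop :=
  smooth_field X /\ forall p, (X p <= L p)%MS.

(* Local frames: multiplying by a cut-off function, one may take the members of
   a frame around p to be sections over all of M. *)
Definition subbundle (k : nat) (L : plane_field) : Prop :=
  forall p : M, exists X : 'I_k -> vfield,
    (forall i, sections L (X i)) /\
    (\forall q \near p,
       row_free (\matrix_i X i q) /\ (\matrix_i X i q :=: L q)%MS).

(* Integrability in the sense of Frobenius *)
Definition integrable_distr (L : plane_field) : Prop :=
  forall X Y, sections L X -> sections L Y -> sections L (bracket X Y).

Definition flat_distr (xi : vfield) (L : plane_field) : Prop :=
  forall X, sections L X -> sections L (bracket xi X).

Definition conj_distr (phi : endo) (L : plane_field) : plane_field :=
  fun p => L p *m phi p.

Definition reeb (eta : form1) (xi : vfield) : Prop :=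
  [/\ smooth_field xi, forall p, ev eta xi p = 1
    & forall V p, smooth_field V -> dform eta xi V p = 0].

Definition nijenhuis (phi : endo) (V W : vfield) : vfield :=
  app phi (app phi (bracket V W)) + bracket (app phi V) (app phi W)
  - app phi (bracket (app phi V) W) - app phi (bracket V (app phi W)).

(* h = (1/2) L_xi phi *)
Definition h_tensor (phi : endo) (xi V : vfield) : vfield := fun p =>
  2^-1 *: (bracket xi (app phi V) p - app phi (bracket xi V) p).

Definition tanaka_webster (phi : endo) (xi : vfield) (eta : form1)
    (nabla : vfield -> vfield -> vfield) (V W : vfield) : vfield :=
  nabla V W + fscale (ev eta V) (app phi W)
  + fscale (ev eta W) (app phi V + app phi (h_tensor phi xi V))
  + fscale (dform eta (V + h_tensor phi xi V) W) xi.

Definition bileg_H (eta : form1) (V W : vfield) : vfield :=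
  xget 0 [set U : vfield | [/\ smooth_field U, forall p, ev eta U p = 0
    & forall Z, smooth_field Z -> (forall p, ev eta Z p = 0) ->
      forall p, dform eta U Z p =
        dird V (dform eta W Z : M -> R^o) p - dform eta W (bracket V Z) p]].

(* Projection onto the first of three complementary distributions *)
Definition proj3 (L1 L2 L3 : plane_field) (V : vfield) : vfield :=
  app (fun p => proj_mx (L1 p) (L2 p + L3 p)%MS) V.

Definition line (xi : vfield) : plane_field := fun p => <<xi p>>%MS.

(* The bi-Legendrian connection of (L1, L2), on
   W = W_L1 + W_L2 + eta(W) xi *)
Definition bileg (eta : form1) (xi : vfield) (L1 L2 : plane_field)
    (V W : vfield) : vfield :=
  let E := line xi in
  let pr1 := proj3 L1 L2 E in
  let pr2 := proj3 L2 L1 E in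
  let pr3 := proj3 E L1 L2 in
  let X := pr1 W in
  let Y := pr2 W in
  (pr1 (bileg_H eta (pr1 V) X) + pr1 (bracket (pr2 V) X)
   + pr1 (bracket (pr3 V) X))
  + (pr2 (bileg_H eta (pr2 V) Y) + pr2 (bracket (pr1 V) Y)
   + pr2 (bracket (pr3 V) Y))
  + fscale (dird V (ev eta W : M -> R^o)) xi.

End Geometry.

Arguments vfield : clear implicits.
Arguments endo : clear implicits.
Arguments form1 : clear implicits.
Arguments plane_field : clear implicits.

Section Contact.
Context {R : realType} {n : nat} {M : topologicalType}.
Variable S : manifold R n.*2.+1 M.
Local Notation vfield := (vfield R n.*2.+1 M).
Local Notation form1 := (form1 R n.*2.+1 M).
Local Notation endo := (endo R n.*2.+1 M).
Local Notation plane_field := (plane_field R n.*2.+1 M).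


Definition legendrian (eta : form1) (L : plane_field) : Prop :=
  [/\ subbundle S n L, forall p, L p *m eta p = 0
    & forall X Y p, sections S L X -> sections S L Y -> dform S eta X Y p = 0].

(* Up to a positive factor, (eta /\ (d eta)^n) (V 0, ..., V (2n)). *)
Definition wedge_contact (eta : form1) (V : 'I_n.*2.+1 -> vfield) : M -> R :=
  fun p => \sum_(s : 'S_n.*2.+1) (-1) ^+ s *
    (ev eta (V (s ord0)) p *
     \prod_(i < n) dform S eta (V (s (inord i.*2.+1)))
                                (V (s (inord i.*2.+2))) p).

Definition contact_form (eta : form1) : Prop :=
  smooth_form1 S eta /\
  forall p, exists V : 'I_n.*2.+1 -> vfield,
    (forall i, smooth_field S (V i)) /\ wedge_contact eta V p != 0.

Definition contact_metric
    (phi : endo) (xi : vfield) (eta : form1) (g : endo) : Prop :=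
  contact_form eta /\ reeb S eta xi /\ riemannian S g /\ smooth_endo S phi /\
  (forall V p, inner g V xi p = ev eta V p) /\
  (forall V, app phi (app phi V) = - V + fscale (ev eta V) xi) /\
  (forall V W p, smooth_field S V -> smooth_field S W ->
     dform S eta V W p = inner g V (app phi W) p).

Definition sasakian
    (phi : endo) (xi : vfield) (eta : form1) (g : endo) : Prop :=
  contact_metric phi xi eta g /\
  forall V W, smooth_field S V -> smooth_field S W ->
    nijenhuis S phi V W + fscale (fun p => 2 * dform S eta V W p) xi = 0.

End Contact.

(* Main.v *)
Require Import Defs.
From HB Require Import structures.
From mathcomp Require Import all_boot all_order all_fingroup all_algebra.
From mathcomp Require Import all_classical all_reals all_analysis ring lra.

Set Implicit Arguments.
Unset Strict Implicit.
Unset Printing Implicit Defensive.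

Import Order.TTheory GRing.Theory Num.Theory.
Import numFieldNormedType.Exports.

Local Open Scope classical_set_scope.
Local Open Scope ring_scope.

(** Write D for the Tanaka-Webster connection.  On a Sasakian manifold the
    tensor h vanishes ([h_tensor0]), so D differs from the Levi-Civita connection
    by explicit tensors; it is metric ([tw_metric]) and its torsion is a multiple
    of xi, that is, [V, W] = D_V W - D_W V - 2 deta(V, W) xi ([tw_torsion]).

    Suppose that D preserves L.  The first step is D xi = 0 ([tw_xi]).  The form
    (V, Z) |-> g(D_V xi, Z) is symmetric, because the skew part of the covariant
    derivative of xi is deta; it vanishes for Z in L, because
    g(X, D_V xi) = V(eta(X)) - eta(D_V X) = 0 for X in L; and it vanishes for
    Z = xi.  There remain two arguments in Q = phi L.  The symmetrized form is the
    Lie derivative of g along xi, which phi leaves invariant on ker eta since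
    h = 0; so its values on Q x Q are values on L x L, hence zero.

    Now D preserves g, L and xi, so it preserves the orthogonal complement Q of
    L + R xi ([presQ]).  As deta vanishes on L and on Q, the torsion formula
    expresses brackets in L, or in Q, by D alone: both are integrable
    ([parallel_legendrian_bracket]).

    To compare D with the bi-Legendrian connection, the delicate point is that
    D_X (phi A) = phi (D_X A) for X and A in the same distribution
    ([pair_tw_phi]).  The trilinear form c(X, A, B) = g(D_X A + phi D_X (phi A), B)
    is symmetric in X and A by the vanishing of the Nijenhuis tensor, and skew in
    A and B since D and phi are compatible with g; such a form is zero.  Hence D_X A
    satisfies the equation that defines H(X, A), whose solution is unique
    ([bileg_H_tw]).  The other terms of the bi-Legendrian connection are
    projections of brackets, read off from the torsion formula ([tw_bileg]).

    All fields must be smooth for these computations, in particular the components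
    of a field along L and Q.  The component along L is expressed near each point
    by a frame of L and the inverse of its Gram matrix, whose entries are smooth
    by Cramer's rule ([pr1_frame], [smooth_pr1]). *)

(** * Calculus of C^k maps *)

Section Calculus.
Context {R : realType} {V : normedModType R}.
Implicit Types (A B : set V) (k : nat).

(** Adding to f the difference h - f, which vanishes near x and so has
    derivative 0 there, gives h. *)
Lemma near_eq_differentiable (W : normedModType R) (f h : V -> W) x :
  {near x, f =1 h} -> differentiable f x -> differentiable h x.
Proof.
move=> fh df.
suff dz : differentiable (h - f) x.
  have -> : h = f + (h - f) by rewrite addrC subrK.
  exact: differentiableD.
have z0 : (h - f) \o shift x = cst ((h - f) x) + (\0%R : {linear V -> W}) +o_ 0 id.
  apply/eqaddoP => e e0.
  have hx : h x = f x by rewrite (nbhs_singleton fh).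
  have fh' : \forall y \near 0, f (y + x) = h (y + x).
    rewrite (near_shift x) /=; near=> z.
    by rewrite /= sub0r subrK (near fh z).
  near=> y; rewrite /= !fctE /= hx subrr addr0 subr0.
  by rewrite (near fh' y) // subrr normr0 mulr_ge0 // ltW.
apply/diff_locallyP; rewrite (diff_unique _ z0) //; last exact: cst_continuous.
by split => //; exact: cst_continuous.
Unshelve. all: by end_near. Qed.

Section Ck.
Context {W : normedModType R}.
Implicit Types f h : V -> W.

Lemma Ck_sub k A B f : B `<=` A -> Ck k A f -> Ck k B f.
Proof.
elim: k f => [|k IH] f sBA /=; first by move=> cf x /sBA /cf.
by move=> [df Df]; split=> [x /sBA /df //|v]; exact: IH.
Qed.

(** C^k on a set is a pointwise condition on full-space derivatives, so it may be
    verified on any family of sets that covers it. *)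
Lemma Ck_germ k A f :
  (forall x, A x -> exists2 B, B x & Ck k B f) -> Ck k A f.
Proof.
elim: k f => [|k IH] f loc /=; first by move=> x /loc[B Bx]; apply.
split=> [x /loc[B Bx [+ _]]|v]; first exact.
by apply: IH => x /loc[B Bx [_ +]] => /(_ v); exists B.
Qed.

Lemma Ck_eq k A f h : open A -> {in A, f =1 h} -> Ck k A f -> Ck k A h.
Proof.
move=> oA; elim: k f h => [|k IH] f h fh.
  move=> cf x Ax; suff: h @ x --> h x by [].
  rewrite -(fh x) ?inE //.
  apply: cvg_trans (cf x Ax); apply: near_eq_cvg.
  by near do rewrite fh // inE; exact: open_nbhs_nbhs.
have nfh x : A x -> {near x, f =1 h}.
  by move=> Ax; near do rewrite fh // inE; exact: open_nbhs_nbhs.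
move=> [df Df]; split=> [x Ax|v].
  exact: near_eq_differentiable (nfh _ Ax) (df _ Ax).
apply: (IH (fun x => 'D_v f x)); last exact: Df.
by move=> x; rewrite inE => /nfh; exact: near_eq_derive.
Unshelve. all: by end_near. Qed.

Lemma CkW k A f : Ck k.+1 A f -> Ck k A f.
Proof.
elim: k f => [|k IH] f [df Df].
  by move=> x /df; exact: differentiable_continuous.
by split => // v; apply: IH.
Qed.

Lemma Ck_cst k A (w : W) : Ck k A (cst w).
Proof.
elim: k w => [|k IH] w /=; first by move=> x _; exact: cst_continuous.
split=> [x _|v]; first exact: differentiable_cst.
rewrite (_ : (fun x => _) = cst 0); first exact: IH.
by apply/funext => x; rewrite derive_cst.
Qed.

Lemma CkD k A f h : open A -> Ck k A f -> Ck k A h -> Ck k A (f \+ h).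
Proof.
move=> oA; elim: k f h => [|k IH] f h.
  by move=> cf ch x Ax; apply: cvgD; [exact: cf|exact: ch].
move=> [df Df] [dh Dh]; split=> [x Ax|v].
  by apply: differentiableD; [exact: df|exact: dh].
apply: Ck_eq (IH _ _ (Df v) (Dh v)) => // x; rewrite inE => Ax /=.
by rewrite [RHS]deriveD //; apply: diff_derivable; [exact: df|exact: dh].
Qed.

Lemma Ck_sum (I : Type) (r : seq I) (P : pred I) k A (F : I -> V -> W) :
  open A -> (forall i, Ck k A (F i)) ->
  Ck k A (fun x => \sum_(i <- r | P i) F i x).
Proof.
move=> oA CF; elim: r => [|i r IH].
  by under eq_fun do rewrite big_nil; exact: Ck_cst.
under eq_fun do rewrite big_cons; case: (P i) => //.
exact: CkD (CF i) IH.
Qed.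

End Ck.

(** The product rule, seen as differentiability of the continuous bilinear map
    of scalar multiplication along a pair of maps. *)
Lemma differentiable_scale (W : normedModType R) (c : V -> R^o) (f : V -> W) x :
  differentiable c x -> differentiable f x ->
  differentiable (fun y => c y *: f y) x /\
  forall v, 'D_v (fun y => c y *: f y) x = 'D_v c x *: f x + c x *: 'D_v f x.
Proof.
move=> dc df.
have lin : bilinear_for (GRing.Scale.Law.clone _ _ *:%R _)
    (GRing.Scale.Law.clone _ _ *:%R _) (fun (a : R^o) (w : W) => a *: w).
  split=> [w|a] b y z /=; first by rewrite scalerDl scalerA.
  by rewrite scalerDr !scalerA mulrC.
pose bm := bilinear_isBilinear.Build R R^o W W _ _ _ lin.
pose b : {bilinear R^o -> W -> W} := HB.pack (fun (a : R^o) (w : W) => a *: w) bm.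
have bc : continuous (fun p => b p.1 p.2) by move=> p; exact: scale_continuous.
have dp := differentiable_pair dc df.
have db := differentiable_bilin (c x, f x) bc.
have E : (fun y => c y *: f y) = (fun p => b p.1 p.2) \o (fun y => (c y, f y)) by [].
have dE : differentiable (fun y => c y *: f y) x.
  by rewrite E; exact: differentiable_comp.
split=> // v; rewrite !deriveE // E diff_comp // diff_bilin // diff_pair //=.
by rewrite addrC.
Qed.

Lemma CkZ (W : normedModType R) k A (c : V -> R^o) (f : V -> W) :
  open A -> Ck k A c -> Ck k A f -> Ck k A (fun x => c x *: f x).
Proof.
move=> oA; elim: k c f => [|k IH] c f.
  by move=> cc cf x Ax; apply: cvgZ; [exact: cc|exact: cf].
move=> Cc Cf; have [dc Dc] := Cc; have [df Df] := Cf.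
have dcf x (Ax : A x) := differentiable_scale (dc x Ax) (df x Ax).
split=> [x /dcf[]//|v].
apply: Ck_eq (CkD oA (IH _ _ (Dc v) (CkW Cf)) (IH _ _ (CkW Cc) (Df v))) => // x.
by rewrite inE => /dcf[_ ->].
Qed.

Lemma Ck_prod (I : Type) (r : seq I) (P : pred I) k A (F : I -> V -> R^o) :
  open A -> (forall i, Ck k A (F i)) ->
  Ck k A ((fun x => \prod_(i <- r | P i) F i x) : V -> R^o).
Proof.
move=> oA CF; elim: r => [|i r IH].
  by under eq_fun do rewrite big_nil; exact: Ck_cst.
under eq_fun do rewrite big_cons; case: (P i) => //.
exact: CkZ (CF i) IH.
Qed.

Lemma CkV k A (f : V -> R^o) : open A -> (forall x, A x -> f x != 0) ->
  Ck k A f -> Ck k A ((fun x => (f x)^-1) : V -> R^o).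
Proof.
move=> oA f0; elim: k => [|k IH].
  by move=> cf x Ax; apply: cvgV; [exact: f0|exact: cf].
move=> Cf; have [df Df] := Cf; split=> [x Ax|v].
  by apply: differentiableV; [exact: df|exact: f0].
have CV := IH (CkW Cf).
apply: Ck_eq (CkZ oA (Ck_cst _ _ (-1 : R^o)) (CkZ oA CV (CkZ oA CV (Df v)))) => //.
move=> x; rewrite inE => Ax /=.
rewrite [RHS]deriveV ?f0 //; last by apply: diff_derivable; exact: df.
by rewrite scaleN1r scaleNr -exprVn expr2 scalerA.
Qed.

Lemma Ck_det n k A (F : V -> 'M[R]_n) : open A ->
  (forall i j, Ck k A ((fun x => F x i j) : V -> R^o)) ->
  Ck k A ((fun x => \det (F x)) : V -> R^o).
Proof.
move=> oA CF; apply: Ck_sum => // s.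
by apply: CkZ => //; [exact: Ck_cst|exact: Ck_prod].
Qed.

(** Cramer's rule: the entries of the inverse are cofactors over the determinant. *)
Lemma Ck_invmx n k A (F : V -> 'M[R]_n) i j : open A ->
  (forall x, A x -> F x \in unitmx) ->
  (forall i j, Ck k A ((fun x => F x i j) : V -> R^o)) ->
  Ck k A ((fun x => invmx (F x) i j) : V -> R^o).
Proof.
move=> oA uF CF.
have Cadj : Ck k A ((fun x => \adj (F x) i j) : V -> R^o).
  have -> : (fun x => \adj (F x) i j) = (fun x => ((-1) ^+ (j + i) : R) *:
      (\det (row' j (col' i (F x))) : R^o)).
    by apply/funext => x; rewrite mxE.
  apply: CkZ => //; first exact: Ck_cst.
  by apply: Ck_det => // a b; under eq_fun do rewrite !mxE; exact: CF.
have dF0 x : A x -> \det (F x) != 0 by move=> Ax; rewrite -unitfE -unitmxE uF.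
apply: Ck_eq (CkZ oA (CkV oA dF0 (Ck_det oA CF)) Cadj) => // x.
by rewrite inE => /uF uFx; rewrite /invmx uFx [RHS]mxE.
Qed.

End Calculus.

(** * Smooth functions and fields on open sets *)

Section SmoothObjects.
Context {R : realType} {m : nat} {M : topologicalType} (S : manifold R m M).
Local Notation vfield := (vfield R m M).
Implicit Types (V W : vfield) (U : set M) (p q : M).

(** Coefficients with respect to a local frame are smooth only where the frame is
    defined; hence the versions relative to an open set. *)
Definition smooth_fun_on U (f : M -> R) : Prop := forall p,
  smooth_on (chart S p @` (chart_dom S p `&` U)) ((f : M -> R^o) \o chart_inv S p).

Definition smooth_field_on U V : Prop := forall p,
  smooth_on (chart S p @` (chart_dom S p `&` U))
            (dird S V (chart S p) \o chart_inv S p).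

Lemma smooth_funT f : smooth_fun_on setT f <-> smooth_fun S f.
Proof. by split=> sf p; have := sf p; rewrite setIT. Qed.

Lemma smooth_fieldT V : smooth_field_on setT V <-> smooth_field S V.
Proof. by split=> sV p; have := sV p; rewrite setIT. Qed.

Lemma smooth_funW U f : smooth_fun S f -> smooth_fun_on U f.
Proof.
move=> sf p k; apply: Ck_sub (sf p k).
by apply: image_subset => q [].
Qed.

Lemma smooth_fieldW U V : smooth_field S V -> smooth_field_on U V.
Proof.
move=> sV p k; apply: Ck_sub (sV p k).
by apply: image_subset => q [].
Qed.

(** A chart is a homeomorphism onto its open image. *)
Lemma chart_image_open p U : open U -> open (chart S p @` (chart_dom S p `&` U)).
Proof.
move=> oU; rewrite openE => _ [q [dq Uq] <-].
have [odom _] := chart_dom_open S p.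
have nq : nbhs q (chart_dom S p `&` U).
  by apply: open_nbhs_nbhs; split => //; exact: openI.
have himg : nbhs (chart S p q) (chart S p @` chart_dom S p).
  apply: open_nbhs_nbhs; split; [exact: chart_img_open|by exists q].
have hinv : nbhs (chart S p q) (chart_inv S p @^-1` (chart_dom S p `&` U)).
  by apply: (chart_inv_continuous dq); rewrite chartK.
apply: filterS2 himg hinv => _ [r dr <-] /=; rewrite chartK // => dUr.
by exists r.
Qed.

Lemma smooth_field_local V :
  (forall p, exists U, [/\ open U, U p & smooth_field_on U V]) -> smooth_field S V.
Proof.
move=> loc p k; apply: Ck_germ => _ [q dq <-].
have [U [oU Uq sV]] := loc q.
by exists (chart S p @` (chart_dom S p `&` U)); [exists q|exact: sV].
Qed.

Lemma differentiable_transition p q : chart_dom S p q ->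
  differentiable (chart S p \o chart_inv S q) (chart S q q).
Proof.
move=> dq; have [+ _] := chart_transition_smooth S q p 1.
by apply; exists q => //; split => //; have [] := chart_dom_open S q.
Qed.

(** The components of a field in another chart depend linearly on its value; this
    transfers closure properties of C^k maps to fields. *)
Lemma dird_chart V p q : chart_dom S p q ->
  dird S V (chart S p) q = 'd (chart S p \o chart_inv S q) (chart S q q) (V q).
Proof. by move=> /differentiable_transition ?; rewrite /dird deriveE. Qed.

Lemma differentiable_smooth_fun f p : smooth_fun S f ->
  differentiable ((f : M -> R^o) \o chart_inv S p) (chart S p p).
Proof.
move=> sf; have [+ _] := sf p 1; apply.
by exists p => //; have [] := chart_dom_open S p.
Qed.

Lemma dird0 (W : normedModType R) (F : M -> W) : dird S (0 : vfield) F = cst 0.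
Proof. by apply/funext => p; rewrite /dird derive0. Qed.

Section OnOpen.
Context (U : set M) (oU : open U).

Lemma smooth_field_onD V W :
  smooth_field_on U V -> smooth_field_on U W -> smooth_field_on U (V + W).
Proof.
move=> sV sW p k; have oA := chart_image_open (p := p) oU.
apply: Ck_eq (CkD oA (sV p k) (sW p k)) => // x.
rewrite inE => -[q [dq _] <-] /=; rewrite chartK //.
by rewrite !dird_chart // -linearD.
Qed.

Lemma smooth_field_onZ f V :
  smooth_fun_on U f -> smooth_field_on U V -> smooth_field_on U (fscale f V).
Proof.
move=> sf sV p k; have oA := chart_image_open (p := p) oU.
apply: Ck_eq (CkZ oA (sf p k) (sV p k)) => // x.
rewrite inE => -[q [dq _] <-] /=; rewrite chartK //.
by rewrite !dird_chart // -linearZ.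
Qed.

Lemma smooth_fun_on_cst (c : R) : smooth_fun_on U (cst c).
Proof. by move=> p k; exact: Ck_cst. Qed.

Lemma smooth_field_on0 : smooth_field_on U 0.
Proof. by move=> p k; rewrite dird0; exact: Ck_cst. Qed.

Lemma smooth_field_on_sum (I : Type) (r : seq I) (F : I -> vfield) :
  (forall i, smooth_field_on U (F i)) ->
  smooth_field_on U (fun q => \sum_(i <- r) F i q).
Proof.
move=> sF; elim: r => [|i r IH].
  by under eq_fun do rewrite big_nil; exact: smooth_field_on0.
by under eq_fun do rewrite big_cons; exact: smooth_field_onD (sF i) IH.
Qed.

Lemma smooth_field_on_eq V W :
  {in U, V =1 W} -> smooth_field_on U V -> smooth_field_on U W.
Proof.
move=> VW sV p k; have oA := chart_image_open (p := p) oU.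
apply: (Ck_eq oA _ (sV p k)) => x; rewrite inE => -[q [dq Uq] <-] /=.
have VWq : V q = W q by apply: VW; rewrite inE.
by rewrite (chartK dq) !(dird_chart _ dq) VWq.
Qed.

Lemma smooth_fun_on_sum (I : Type) (r : seq I) (F : I -> M -> R) :
  (forall i, smooth_fun_on U (F i)) ->
  smooth_fun_on U (fun q => \sum_(i <- r) F i q).
Proof.
move=> sF p k; have oA := chart_image_open (p := p) oU.
exact: (@Ck_sum _ _ R^o I r xpredT k _ (fun i => F i \o chart_inv S p) oA
  (fun i => sF i p k)).
Qed.

Lemma smooth_fun_onM (f h : M -> R) : smooth_fun_on U f -> smooth_fun_on U h ->
  smooth_fun_on U (fun q => f q * h q).
Proof.
move=> sf sh p k; have oA := chart_image_open (p := p) oU.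
exact: (CkZ oA (sf p k) (sh p k)).
Qed.

Lemma smooth_invmx_on k (G : M -> 'M[R]_k) i j :
  (forall q, U q -> G q \in unitmx) ->
  (forall a b, smooth_fun_on U (fun q => G q a b)) ->
  smooth_fun_on U (fun q => invmx (G q) i j).
Proof.
move=> uG sG p r; have oA := chart_image_open (p := p) oU.
apply: (@Ck_invmx _ _ _ _ _ (G \o chart_inv S p)) => // [_ [q [dq Uq] <-]|a b].
  by rewrite /= chartK //; exact: uG.
exact: sG.
Qed.

End OnOpen.

Lemma smooth_cst (c : R) : smooth_fun S (cst c).
Proof. exact/smooth_funT/smooth_fun_on_cst. Qed.

Lemma smooth_fieldD V W :
  smooth_field S V -> smooth_field S W -> smooth_field S (V + W).
Proof.
move=> /smooth_fieldT sV /smooth_fieldT sW.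
exact/smooth_fieldT/(smooth_field_onD openT sV sW).
Qed.

Lemma smooth_fscale f V :
  smooth_fun S f -> smooth_field S V -> smooth_field S (fscale f V).
Proof.
move=> /smooth_funT sf /smooth_fieldT sV.
exact/smooth_fieldT/(smooth_field_onZ openT sf sV).
Qed.

Lemma smooth_fieldN V : smooth_field S V -> smooth_field S (- V).
Proof.
move=> sV; have -> : - V = fscale (cst (-1)) V.
  by apply/funext => p; rewrite /fscale scaleN1r.
exact: smooth_fscale (smooth_cst _) sV.
Qed.

Lemma smooth_fieldB V W :
  smooth_field S V -> smooth_field S W -> smooth_field S (V - W).
Proof. by move=> sV /smooth_fieldN; exact: smooth_fieldD. Qed.

Lemma dirdN V f p : smooth_fun S f ->
  dird S V (- f : M -> R^o) p = - dird S V (f : M -> R^o) p.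
Proof.
move=> sf; rewrite /dird.
have -> : (- f : M -> R^o) \o chart_inv S p = - (f \o chart_inv S p) by [].
by rewrite deriveN //; apply: diff_derivable; exact: differentiable_smooth_fun.
Qed.

Lemma dird_cst V (c : R) : dird S V (cst c : M -> R^o) = cst 0.
Proof. by apply/funext => p; rewrite /dird derive_cst. Qed.

Lemma bracket0 W : bracket S 0 W = 0.
Proof.
by apply/funext => p; rewrite /bracket !dird0 /dird derive_cst subr0.
Qed.

Lemma bracketC V W : bracket S V W = - bracket S W V.
Proof. by apply/funext => p; rewrite /bracket fctE opprB. Qed.

End SmoothObjects.

(** * Pointwise algebra of tensors *)

(** The metric pairing, sealed so that it is handled through bilinearity only. *)
HB.lock Definition ip (R : realType) (m : nat) (M : topologicalType)
  (g : endo R m M) (V W : vfield R m M) (p : M) : R := inner g V W p.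

Section TensorAlgebra.
Context {R : realType} {m : nat} {M : topologicalType}.
Local Notation vfield := (vfield R m M).
Context (g phi : endo R m M) (eta : form1 R m M).
Implicit Types (U V W : vfield) (f : M -> R) (p : M).

Lemma fscaleE f V p : fscale f V p = f p *: V p.
Proof. by []. Qed.

Lemma innerE V W : inner g V W = ip g V W.
Proof. by rewrite ip.unlock. Qed.

Lemma ip0l W p : ip g 0 W p = 0.
Proof. by rewrite ip.unlock /inner !mul0mx mxE. Qed.

Lemma ipDl U V W p : ip g (U + V) W p = ip g U W p + ip g V W p.
Proof. by rewrite ip.unlock /inner !mulmxDl mxE. Qed.

Lemma ipDr U V W p : ip g W (U + V) p = ip g W U p + ip g W V p.
Proof. by rewrite ip.unlock /inner linearD mulmxDr mxE. Qed.

Lemma ipNl V W p : ip g (- V) W p = - ip g V W p.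
Proof. by rewrite ip.unlock /inner !mulNmx mxE. Qed.

Lemma ipNr V W p : ip g W (- V) p = - ip g W V p.
Proof. by rewrite ip.unlock /inner linearN mulmxN mxE. Qed.

Lemma ipZl f V W p : ip g (fscale f V) W p = f p * ip g V W p.
Proof. by rewrite ip.unlock /inner /fscale -!scalemxAl mxE. Qed.

Lemma ipZr f V W p : ip g W (fscale f V) p = f p * ip g W V p.
Proof. by rewrite ip.unlock /inner /fscale linearZ -scalemxAr mxE. Qed.

Lemma evD V W p : ev eta (V + W) p = ev eta V p + ev eta W p.
Proof. by rewrite /ev mulmxDl mxE. Qed.

Lemma evN V p : ev eta (- V) p = - ev eta V p.
Proof. by rewrite /ev mulNmx mxE. Qed.

Lemma evZ f V p : ev eta (fscale f V) p = f p * ev eta V p.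
Proof. by rewrite /ev /fscale -scalemxAl mxE. Qed.

Lemma appD V W : app phi (V + W) = app phi V + app phi W.
Proof. by apply/funext => p; rewrite /app mulmxDl. Qed.

Lemma appN V : app phi (- V) = - app phi V.
Proof. by apply/funext => p; rewrite /app mulNmx. Qed.

Lemma appZ f V : app phi (fscale f V) = fscale f (app phi V).
Proof. by apply/funext => p; rewrite /app /fscale -scalemxAl. Qed.

Lemma app0 : app phi 0 = 0.
Proof. by apply/funext => p; rewrite /app mul0mx. Qed.

End TensorAlgebra.

Lemma mulmx_row (R : pzRingType) k l m r (A : 'M[R]_(k, m)) (B : 'M[R]_(m, r))
    (C : 'M[R]_(l, r)) i j :
  (A *m B *m C^T) i j = (row i A *m B *m (row j C)^T) 0 0.
Proof.
rewrite -row_mul !mxE; apply: eq_bigr => a _.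
by rewrite [row _ _ _ _]mxE [(row _ _)^T _ _]mxE !mxE.
Qed.

(** * Contact metric structures *)

Section ContactMetric.
Context {R : realType} {n : nat} {M : topologicalType}.
Context (S : manifold R n.*2.+1 M).
Local Notation vfield := (vfield R n.*2.+1 M).
Context (phi : endo R n.*2.+1 M) (xi : vfield) (eta : form1 R n.*2.+1 M).
Context (g : endo R n.*2.+1 M).
Context (cm : contact_metric S phi xi eta g).
Implicit Types (U V W X Y Z : vfield) (p : M).
Local Notation smooth := (smooth_field S).

Let smooth_ev V : smooth V -> smooth_fun S (ev eta V).
Proof. by case: cm => -[+ _] _; apply. Qed.

Let smooth_xi : smooth xi.
Proof. by case: cm => _ [[]]. Qed.

Let ev_xi p : ev eta xi p = 1.
Proof. by case: cm => _ [[_ + _]] _; apply. Qed.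

Let smooth_inner V W : smooth V -> smooth W -> smooth_fun S (ip g V W).
Proof. by rewrite -innerE; case: cm => _ [_ [[+ _ _] _]]; apply. Qed.

Lemma ipC V W p : ip g V W p = ip g W V p.
Proof.
case: cm => _ [_ [[_ gT _] _]].
have gE : W p *m g p *m (V p)^T = (V p *m g p *m (W p)^T)^T.
  by rewrite !trmx_mul trmxK gT mulmxA.
by rewrite -!innerE /inner gE [RHS]mxE.
Qed.

Lemma ip_eq0 V p : ip g V V p = 0 -> V p = 0.
Proof.
case: cm => _ [_ [[_ _ gpos] _]] V0; apply/eqP/contraT => /(gpos p).
by rewrite -/(inner g V V p) innerE V0 ltxx.
Qed.

Let smooth_app V : smooth V -> smooth (app phi V).
Proof. by case: cm => _ [_ [_ [+ _]]]; apply. Qed.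

Lemma ip_xi V p : ip g V xi p = ev eta V p.
Proof. by rewrite -innerE; case: cm => _ [_ [_ [_ [+ _]]]]; apply. Qed.

Lemma phi2 V : app phi (app phi V) = - V + fscale (ev eta V) xi.
Proof. by case: cm => _ [_ [_ [_ [_ [+ _]]]]]; apply. Qed.

Lemma dformE V W : smooth V -> smooth W ->
  dform S eta V W = ip g V (app phi W).
Proof.
move=> sV sW; rewrite -innerE; apply/funext => p.
by case: cm => _ [_ [_ [_ [_ [_ +]]]]]; apply.
Qed.

Lemma dformC V W p : dform S eta V W p = - dform S eta W V p.
Proof.
by rewrite /dform (bracketC S W) evN; ring.
Qed.

Lemma ip_phil V W p : smooth V -> smooth W ->
  ip g (app phi V) W p = - ip g V (app phi W) p.
Proof. by move=> sV sW; rewrite ipC -!dformE // dformC. Qed.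

(** g(phi xi, phi xi) = deta(phi xi, xi), which is zero for the Reeb field. *)
Lemma phi_xi : app phi xi = 0.
Proof.
have sphixi := smooth_app smooth_xi.
have dxi p : dform S eta xi (app phi xi) p = 0.
  by case: cm => _ [[_ _ +] _]; apply.
apply/funext => p.
apply: (@ip_eq0 (app phi xi) p).
by rewrite -(dformE sphixi smooth_xi) dformC dxi oppr0.
Qed.

(** phi^3 computed in two ways differs by eta(phi V) xi. *)
Lemma ev_phi V p : ev eta (app phi V) p = 0.
Proof.
have : app phi (app phi (app phi V)) p = - app phi V p.
  by rewrite (phi2 V) appD appN appZ phi_xi /fscale /= fctE scaler0 addr0.
rewrite phi2 fctE => /(canRL (addKr _)); rewrite addNr => e0.
by rewrite -[LHS]mulr1 -(ev_xi p) -evZ /ev e0 mul0mx mxE.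
Qed.

Lemma ip_phi2 V W p : smooth V -> smooth W ->
  ip g (app phi V) (app phi W) p =
  ip g V W p - ev eta V p * ev eta W p.
Proof.
move=> sV sW; rewrite (ip_phil _ sV (smooth_app sW)).
by rewrite phi2 ipDr ipNr ipZr ip_xi opprD opprK mulrC.
Qed.

Lemma smooth_dform V W : smooth V -> smooth W -> smooth_fun S (dform S eta V W).
Proof. by move=> sV sW; rewrite (dformE sV sW); exact: smooth_inner (smooth_app sW). Qed.

(** * The Tanaka-Webster connection of a Sasakian manifold *)

Section Connection.
Context (nabla : vfield -> vfield -> vfield).
Context (lc : levi_civita S g nabla).
Context (nij : forall V W, smooth V -> smooth W ->
    nijenhuis S phi V W + fscale (fun p => 2 * dform S eta V W p) xi = 0).

(** The Nijenhuis condition at (xi, V) says that phi kills 2 h V; and eta(h V) = 0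
    since deta(xi, phi V) = 0, whence phi^2 (h V) = - h V forces h V = 0. *)
Lemma h_tensor0 V : smooth V -> h_tensor S phi xi V = 0.
Proof.
move=> sV; have sphiV := smooth_app sV.
pose U := bracket S xi (app phi V) - app phi (bracket S xi V).
suff U0 : U = 0.
  by apply/funext => p; rewrite /h_tensor -[X in _ *: X]/(U p) U0 scaler0.
have dxi0 W p : smooth W -> dform S eta xi W p = 0.
  by case: cm => _ [[_ _ +] _] sW; apply.
have phiU : app phi U = 0.
  have := nij smooth_xi sV; rewrite /nijenhuis phi_xi bracket0 addr0 bracket0 app0 subr0.
  rewrite -[_ - _]opprB -appN -appD => /(canRL (addrK _)).
  rewrite sub0r => /(congr1 (@GRing.opp _)); rewrite !opprK => ->.
  by apply/funext => p; rewrite /fscale (dxi0 _ _ sV) mulr0 scale0r.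
have evU p : ev eta U p = 0.
  rewrite evD evN ev_phi subr0.
  have := dxi0 _ p sphiV; rewrite /dform.
  have -> : ev eta (app phi V) = cst 0 by apply/funext => q; exact: ev_phi.
  have -> : ev eta xi = cst 1 by apply/funext => q; exact: ev_xi.
  rewrite !dird_cst subrr sub0r => /eqP; rewrite mulf_eq0 invr_eq0 pnatr_eq0 /=.
  by rewrite oppr_eq0 => /eqP.
have := phi2 U; rewrite phiU app0 => /esym/addr0_eq; rewrite opprK => ->.
by apply/funext => p; rewrite /fscale evU scale0r.
Qed.

(* From here on the connection and the bracket are names, used only through the
   laws derived below. *)
Context (tw br : vfield -> vfield -> vfield).
Context (tw_def : tw = tanaka_webster S phi xi eta nabla) (br_def : br = bracket S).

Lemma twE V W : smooth V ->
  tw V W = nabla V W + fscale (ev eta V) (app phi W)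
    + fscale (ev eta W) (app phi V) + fscale (dform S eta V W) xi.
Proof. by move=> sV; rewrite tw_def /tanaka_webster (h_tensor0 sV) app0 !addr0. Qed.

Let smooth_nabla V W : smooth V -> smooth W -> smooth (nabla V W).
Proof. by case: lc => + _; apply. Qed.

Lemma smooth_tw V W : smooth V -> smooth W -> smooth (tw V W).
Proof.
move=> sV sW; rewrite (twE _ sV).
have s1 := smooth_nabla sV sW.
have s2 := smooth_fscale (smooth_ev sV) (smooth_app sW).
have s3 := smooth_fscale (smooth_ev sW) (smooth_app sV).
have s4 := smooth_fscale (smooth_dform sV sW) smooth_xi.
exact: (smooth_fieldD (smooth_fieldD (smooth_fieldD s1 s2) s3) s4).
Qed.

Lemma tw_torsion V W : smooth V -> smooth W ->
  br V W = tw V W - tw W V - fscale (fun p => 2 * dform S eta V W p) xi.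
Proof.
case: lc => _ [_ [_ [_ [_ [tors _]]]]] sV sW.
apply/funext => p; rewrite br_def -(tors _ _ sV sW) (twE W sV) (twE V sW) /fscale !fctE.
rewrite (dformC W V).
move: (nabla V W p) (nabla W V p) (app phi V p) (app phi W p) (xi p) => a b c d e.
move: (ev eta V p) (ev eta W p) (dform S eta V W p) => x y z.
by apply/rowP => j; rewrite !mxE; ring.
Qed.

(** The correction eta(U) phi is skew for g; the one in eta(V) cancels the component
    deta(U, W) xi of tw U W, as g(phi U, W) = - deta(U, W), and likewise with V and W
    exchanged. *)
Lemma tw_metric U V W p : smooth U -> smooth V -> smooth W ->
  dird S U (ip g V W : M -> R^o) p =
  ip g (tw U V) W p + ip g V (tw U W) p.
Proof.
case: lc => _ [_ [_ [_ [_ [_ met]]]]] sU sV sW.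
rewrite -innerE (met _ _ _ sU sV sW) !innerE (twE V sU) (twE W sU) !fctE.
rewrite !ipDl !ipDr !ipZl !ipZr ip_xi.
rewrite (ipC xi) ip_xi (ipC V (app phi U)).
rewrite !(ip_phil p) // (dformE sU sV) (dformE sU sW).
by ring.
Qed.

Lemma twDr V X Y : smooth V -> smooth X -> smooth Y ->
  tw V (X + Y) = tw V X + tw V Y.
Proof.
case: lc => _ [_ [_ [add _]]] sV sX sY; have sXY := smooth_fieldD sX sY.
rewrite !(twE _ sV) (add _ _ _ sV sX sY) appD (dformE sV sXY) (dformE sV sX).
rewrite (dformE sV sY) appD; apply/funext => p.
rewrite /fscale !fctE evD ipDr.
move: (nabla V X p) (nabla V Y p) (app phi X p) (app phi Y p) => a b c d.
move: (app phi V p) (xi p) => e f.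
move: (ev eta V p) (ev eta X p) (ev eta Y p) => x y z.
move: (ip g V (app phi X) p) (ip g V (app phi Y) p) => t u.
by apply/rowP => j; rewrite !mxE; ring.
Qed.

Lemma twDl V W X : smooth V -> smooth W -> smooth X ->
  tw (V + W) X = tw V X + tw W X.
Proof.
case: lc => _ [add _] sV sW sX; have sVW := smooth_fieldD sV sW.
rewrite !twE // (add _ _ _ sV sW sX) appD (dformE sVW sX) (dformE sV sX).
rewrite (dformE sW sX); apply/funext => p.
rewrite /fscale !fctE evD ipDl.
move: (nabla V X p) (nabla W X p) (app phi V p) (app phi W p) => a b c d.
move: (app phi X p) (xi p) => e f.
move: (ev eta V p) (ev eta W p) (ev eta X p) => x y z.
move: (ip g V (app phi X) p) (ip g W (app phi X) p) => t u.
by apply/rowP => j; rewrite !mxE; ring.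
Qed.

Lemma tw_scaler f V W : smooth_fun S f -> smooth V -> smooth W ->
  tw V (fscale f W) = fscale (dird S V (f : M -> R^o)) W + fscale f (tw V W).
Proof.
case: lc => _ [_ [_ [_ [leib _]]]] sf sV sW; have sfW := smooth_fscale sf sW.
rewrite !(twE _ sV) (leib _ _ _ sf sV sW) appZ (dformE sV sfW) (dformE sV sW).
rewrite appZ; apply/funext => p; rewrite /fscale !fctE evZ ipZr.
move: (nabla V W p) (app phi V p) (app phi W p) (W p) (xi p) => a b c d e.
move: (dird S V _ p) (ev eta V p) (ev eta W p) => x y z.
move: (ip g V (app phi W) p) (f p) => t u.
by apply/rowP => j; rewrite !mxE; ring.
Qed.

Lemma smooth_bracket V W : smooth V -> smooth W -> smooth (br V W).
Proof.
case: lc => _ [_ [_ [_ [_ [tors _]]]]] sV sW; rewrite br_def -(tors _ _ sV sW).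
exact: smooth_fieldB (smooth_nabla sV sW) (smooth_nabla sW sV).
Qed.

Lemma ip_bracket V W Z p : smooth V -> smooth W -> ev eta Z p = 0 ->
  ip g (br V W) Z p = ip g (tw V W) Z p - ip g (tw W V) Z p.
Proof.
move=> sV sW Z0; rewrite (tw_torsion sV sW) 2!ipDl 2!ipNl ipZl.
by rewrite (ipC xi) ip_xi Z0 mulr0 oppr0 addr0.
Qed.

Lemma ip_phi2l V W p :
  ip g (app phi (app phi V)) W p = - ip g V W p + ev eta V p * ev eta W p.
Proof. by rewrite phi2 ipDl ipNl ipZl (ipC xi) ip_xi. Qed.

Lemma ip_sum5 U V W X Y Z f p :
  ip g (U + V - W - X + fscale f Y) Z p =
  ip g U Z p + ip g V Z p - ip g W Z p - ip g X Z p + f p * ip g Y Z p.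
Proof. by rewrite 4!ipDl 2!ipNl ipZl. Qed.

Lemma nijE V W : smooth V -> smooth W ->
  app phi (app phi (br V W)) + br (app phi V) (app phi W) - app phi (br (app phi V) W)
    - app phi (br V (app phi W)) + fscale (fun p => 2 * dform S eta V W p) xi = 0.
Proof. by move=> sV sW; rewrite br_def; exact: nij. Qed.

Lemma dform_phi V W p : smooth V -> smooth W ->
  dform S eta (app phi V) (app phi W) p = dform S eta V W p.
Proof.
move=> sV sW; rewrite (dformE (smooth_app sV) (smooth_app sW)) (dformE sV sW).
by rewrite (ip_phi2 _ sV (smooth_app sW)) ev_phi mulr0 subr0.
Qed.

(** The data that L and Q share, on their modules of sections: stating them for a
    predicate lets each argument run for both distributions. *)
Record parallel_legendrian (P : vfield -> Prop) : Prop := ParallelLegendrian {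
  pl_smooth : forall X, P X -> smooth X;
  pl_ev : forall X p, P X -> ev eta X p = 0;
  pl_dform : forall X Y p, P X -> P Y -> dform S eta X Y p = 0;
  pl_add : forall X Y, P X -> P Y -> P (X + Y);
  pl_opp : forall X, P X -> P (- X);
  pl_tw : forall V X, smooth V -> P X -> P (tw V X)
}.

Lemma parallel_legendrian_bracket P X Y :
  parallel_legendrian P -> P X -> P Y -> P (br X Y).
Proof.
move=> PP PX PY; have [sX sY] := (pl_smooth PP PX, pl_smooth PP PY).
suff -> : br X Y = tw X Y - tw Y X.
  exact: (pl_add PP (pl_tw PP sX PY) (pl_opp PP (pl_tw PP sY PX))).
rewrite (tw_torsion sX sY) -[RHS]subr0; congr (_ - _); apply/funext => p.
by rewrite fscaleE (pl_dform PP _ PX PY) mulr0 scale0r.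
Qed.

(** * Compatibility with phi along a conjugate pair *)

Section ConjugatePair.
Context (P Q : vfield -> Prop).
Context (PP : parallel_legendrian P) (QQ : parallel_legendrian Q).
Context (phiP : forall X, P X -> Q (app phi X)).
Context (phiQ : forall Y, Q Y -> P (app phi Y)).

Lemma pair_orth X Y p : P X -> Q Y -> ip g X Y p = 0.
Proof.
move=> PX QY; have PY := phiQ QY.
have := pl_dform PP p PX PY; rewrite (dformE (pl_smooth PP PX) (pl_smooth PP PY)).
rewrite phi2 ipDr ipNr ipZr (pl_ev QQ _ QY) mul0r addr0.
by move=> /eqP; rewrite oppr_eq0 => /eqP.
Qed.

Lemma pair_orthC X Y p : P X -> Q Y -> ip g Y X p = 0.
Proof. by rewrite ipC; exact: pair_orth. Qed.

(* c X A B = g(tw X A + phi (tw X (phi A)), B), with phi moved to B by skewness *)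
Let c X A B p := ip g (tw X A) B p - ip g (tw X (app phi A)) (app phi B) p.

(* Pairing the Nijenhuis identity for (X, A) with B, the derivatives along phi X
   and phi A drop out by orthogonality; the others are c A X B - c X A B. *)
Let c_sym X A B p : P X -> P A -> P B -> c X A B p = c A X B p.
Proof.
move=> PX PA PB.
have [sX sA sB] := And3 (pl_smooth PP PX) (pl_smooth PP PA) (pl_smooth PP PB).
have [sfX sfA sfB] := And3 (smooth_app sX) (smooth_app sA) (smooth_app sB).
have B0 := pl_ev PP p PB; have fB0 := ev_phi B p.
have := nijE sX sA => /(congr1 (fun U => ip g U B p)).
rewrite ip0l ip_sum5 ip_phi2l (ipC xi) ip_xi B0 !mulr0 !addr0.
rewrite (ip_phil _ (smooth_bracket sfX sA) sB).
rewrite (ip_phil _ (smooth_bracket sX sfA) sB).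
rewrite !ip_bracket //.
rewrite (pair_orthC _ PB (pl_tw QQ sfX (phiP PA))).
rewrite (pair_orthC _ PB (pl_tw QQ sfA (phiP PX))).
rewrite (pair_orth _ (pl_tw PP sfX PA) (phiP PB)).
rewrite (pair_orth _ (pl_tw PP sfA PX) (phiP PB)) /c => E.
by apply/eqP; rewrite -subr_eq0 -oppr_eq0 -[X in _ == X]E; apply/eqP; ring.
Qed.

(* g(phi A, phi B) = g(A, B), and the connection is metric. *)
Let c_skew X A B p : P X -> P A -> P B -> c X A B p = - c X B A p.
Proof.
move=> PX PA PB.
have [sX sA sB] := And3 (pl_smooth PP PX) (pl_smooth PP PA) (pl_smooth PP PB).
have gE : ip g (app phi A) (app phi B) = ip g A B.
  apply/funext => q.
  by rewrite (ip_phi2 _ sA sB) (pl_ev PP _ PA) mul0r subr0.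
have := tw_metric p sX (smooth_app sA) (smooth_app sB).
rewrite gE (tw_metric p sX sA sB) (ipC A) (ipC (app phi A)) /c => E.
by apply/eqP; rewrite -subr_eq0 opprK addrACA E -opprD subrr.
Qed.

Let c0 X A B p : P X -> P A -> P B -> c X A B p = 0.
Proof.
move=> PX PA PB; suff E : c X A B p = - c X A B p.
  by move: (c X A B p) E => x E; lra.
(* X A B to A X B, A B X, B A X, B X A, X B A, X A B: three skew swaps *)
rewrite [LHS]c_sym // c_skew // c_sym // c_skew // opprK.
by rewrite c_sym // c_skew.
Qed.

Lemma pair_tw_phi X A : P X -> P A -> tw X (app phi A) = app phi (tw X A).
Proof.
move=> PX PA; have [sX sA] := (pl_smooth PP PX, pl_smooth PP PA).
have QB := pl_tw QQ sX (phiP PA).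
pose U := tw X A + app phi (tw X (app phi A)).
have PU : P U by exact: (pl_add PP (pl_tw PP sX PA) (phiQ QB)).
have U0 : U = 0.
  apply/funext => p; apply: (@ip_eq0 U p).
  rewrite {1}/U ipDl (ip_phil _ (pl_smooth QQ QB) (pl_smooth PP PU)).
  exact: c0.
have := congr1 (app phi) U0; rewrite appD phi2 app0.
have -> : fscale (ev eta (tw X (app phi A))) xi = 0.
  by apply/funext => p; rewrite fscaleE (pl_ev QQ _ QB) scale0r.
by rewrite addr0 => /subr0_eq.
Qed.

(** For Z in ker eta the equation of H(X, A) reads
    X(g(phi A, Z)) = g(phi (tw X A), Z) + g(phi A, [X, Z]); it follows from metricity
    and [pair_tw_phi], as tw Z X is orthogonal to phi A.  The difference U of two
    solutions satisfies deta(U, phi U) = 0, that is g(U, U) = 0. *)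
Lemma bileg_H_tw X A : P X -> P A -> bileg_H S eta X A = tw X A.
Proof.
move=> PX PA; have [sX sA] := (pl_smooth PP PX, pl_smooth PP PA).
have sfA := smooth_app sA; have PT := pl_tw PP sX PA.
have sT := pl_smooth PP PT.
rewrite /bileg_H -br_def; set E := (X in xget _ X).
have ET : E (tw X A).
  split=> [//|p|Z sZ Z0 p]; first exact: pl_ev PT.
  have sXZ := smooth_bracket sX sZ.
  have -> : dform S eta A Z = - ip g (app phi A) Z.
    by apply/funext => q; rewrite (dformE sA sZ) !fctE (ip_phil _ sA sZ) opprK.
  rewrite (dirdN _ _ (smooth_inner sfA sZ)) (tw_metric _ sX sfA sZ).
  rewrite (dformE sT sZ) (dformE sA sXZ) -[LHS]opprK -(ip_phil _ sT sZ).
  rewrite -[X in _ = _ - X]opprK -(ip_phil _ sA sXZ) -(pair_tw_phi PX PA).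
  rewrite (ipC (app phi A) (br _ _)) (ip_bracket sX sZ (ev_phi _ _)).
  rewrite (pair_orth _ (pl_tw PP sZ PX) (phiP PA)) (ipC (app phi A)).
  by ring.
have [sH H0 HE] : E (xget 0 E) by apply: xgetPex; exists (tw X A).
have [_ T0 TE] := ET.
pose U := xget 0 E - tw X A; have sU : smooth U := smooth_fieldB sH sT.
have sfU := smooth_app sU.
apply/subr0_eq/funext => p; apply: (@ip_eq0 U p).
have U0 : ev eta U p = 0 by rewrite evD evN H0 T0 subr0.
have := HE _ sfU (ev_phi U) p; rewrite -(TE _ sfU (ev_phi U)) => /eqP.
rewrite (dformE sH sfU) (dformE sT sfU) phi2 -subr_eq0 -ipNl -ipDl.
by rewrite ipDr ipNr ipZr U0 mul0r addr0 oppr_eq0 => /eqP.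
Qed.

End ConjugatePair.

(** * The orthogonal splitting and the smoothness of its projections *)

Section LegendrianSplitting.
Context (L : plane_field R n.*2.+1 M) (leg : legendrian S eta L).
Local Notation Q := (conj_distr phi L).
Local Notation E := (line xi).
Local Notation pr1 := (proj3 L Q E).
Local Notation pr2 := (proj3 Q L E).
Local Notation pr3 := (proj3 E L Q).

Lemma phi2_mx p k (A : 'M[R]_(k, n.*2.+1)) :
  A *m phi p *m phi p = - A + A *m eta p *m xi p.
Proof.
apply/row_matrixP => i; rewrite row_mul row_mul linearD linearN /= row_mul row_mul.
have := congr1 (fun V => V p) (phi2 (fun _ => row i A)).
rewrite /app /fscale /ev fctE => ->; congr (_ + _).
by rewrite -mul_scalar_mx -mx11_scalar.
Qed.

Lemma L_eta p : L p *m eta p = 0.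
Proof. by case: leg => _ + _; apply. Qed.

Lemma phi2_L p : L p *m phi p *m phi p = - L p.
Proof. by rewrite phi2_mx L_eta mul0mx addr0. Qed.

Lemma xi_mx p : g p *m (xi p)^T = eta p.
Proof.
apply/colP => i; have := ip_xi (fun _ => delta_mx 0 i) p.
by rewrite -innerE /inner /ev -mulmxA -!rowE !mxE.
Qed.

Lemma posdef_mx p (v : 'rV[R]_(n.*2.+1)) : v *m g p *m v^T = 0 -> v = 0.
Proof.
move=> v0; apply: (@ip_eq0 (fun _ => v) p).
by rewrite -innerE /inner v0 mxE.
Qed.

Lemma gT p : (g p)^T = g p.
Proof. by case: cm => _ [_ [[_ + _] _]]; apply. Qed.

Lemma orth_mxC p k l (A : 'M[R]_(k, n.*2.+1)) (B : 'M[R]_(l, n.*2.+1)) :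
  A *m g p *m B^T = 0 -> B *m g p *m A^T = 0.
Proof.
by move=> AB; apply: trmx_inj; rewrite !trmx_mul trmxK gT mulmxA AB trmx0.
Qed.

(** A vector of A that is also in B + C is orthogonal to itself. *)
Lemma orth_cap0 p (A B C : 'M[R]_(n.*2.+1)) :
  A *m g p *m B^T = 0 -> A *m g p *m C^T = 0 -> (A :&: (B + C))%MS = 0.
Proof.
move=> AB AC; apply/eqP; rewrite -submx0; apply/rV_subP => v.
rewrite sub_capmx => /andP[/submxP[a va] /sub_addsmxP[[b c] /= vbc]].
suff -> : v = 0 by exact: sub0mx.
apply: (@posdef_mx p); rewrite {1}va {v va}vbc linearD /= mulmxDr !trmx_mul.
have aA (B' : 'M[R]_(n.*2.+1)) : A *m g p *m B'^T = 0 -> a *m A *m g p *m B'^T = 0.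
  by move=> AD; rewrite -(mulmxA a) -(mulmxA a) AD mulmx0.
by rewrite !mulmxA !aA // !mul0mx addr0.
Qed.

Lemma legendrian_frame p : exists (X : 'I_n -> vfield) (U : set M),
  [/\ forall i, sections S L (X i), open U, U p
    & forall q, U q -> row_free (\matrix_i X i q) /\ (\matrix_i X i q :=: L q)%MS].
Proof.
case: leg => /(_ p)[X [LX nX]] _ _.
have : nbhs p [set q |
    row_free (\matrix_i X i q) /\ (\matrix_i X i q :=: L q)%MS] := nX.
rewrite nbhsE => -[U [oU Up] UX].
by exists X, U; split => // q /UX.
Qed.

Lemma L_orth_Q p : L p *m g p *m (Q p)^T = 0.
Proof.
have [X [U [LX _ Up FX]]] := legendrian_frame p.
have [_ FL] := FX _ Up; set F := \matrix_i X i p in FL.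
have /submxP[W LF] : (L p <= F)%MS by rewrite FL.
have FF : F *m g p *m (F *m phi p)^T = 0.
  apply/matrixP => i j; rewrite mulmx_row row_mul !rowK [RHS]mxE.
  rewrite -[LHS]/(inner g (X i) (app phi (X j)) p) innerE.
  have [[sXi _] [sXj _]] := (LX i, LX j).
  by rewrite -(dformE sXi sXj); case: leg => _ _; apply.
rewrite /conj_distr LF -(mulmxA W F (phi p)) trmx_mul mulmxA -!(mulmxA W).
by rewrite FF mul0mx mulmx0.
Qed.

Lemma Q_eta p : Q p *m eta p = 0.
Proof.
apply/colP => i; rewrite [RHS]mxE -(ev_phi (fun _ => row i (L p)) p).
by rewrite /ev /app /conj_distr -!row_mul [RHS]mxE.
Qed.

Lemma xi_E p : exists a : 'M[R]_(n.*2.+1, 1), E p = a *m xi p.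
Proof. by apply/submxP; rewrite genmxE. Qed.

Lemma orth_E p k (A : 'M[R]_(k, n.*2.+1)) :
  A *m eta p = 0 -> A *m g p *m (E p)^T = 0.
Proof.
by move=> A0; have [a ->] := xi_E p; rewrite trmx_mul mulmxA -(mulmxA A) xi_mx A0 mul0mx.
Qed.

Lemma cap_L p : (L p :&: (Q p + E p))%MS = 0.
Proof. exact: orth_cap0 (L_orth_Q p) (orth_E (L_eta p)). Qed.

Lemma cap_Q p : (Q p :&: (L p + E p))%MS = 0.
Proof. exact: orth_cap0 (orth_mxC (L_orth_Q p)) (orth_E (Q_eta p)). Qed.

Lemma cap_E p : (E p :&: (L p + Q p))%MS = 0.
Proof.
exact: orth_cap0 (orth_mxC (orth_E (L_eta p))) (orth_mxC (orth_E (Q_eta p))).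
Qed.

Lemma rank_L p : \rank (L p) = n.
Proof.
have [X [U [_ _ Up FX]]] := legendrian_frame p.
by have [/eqP rF FL] := FX _ Up; rewrite -FL.
Qed.

(** phi^2 = -1 on L, so neither application of phi lowers the rank. *)
Lemma rank_Q p : \rank (Q p) = n.
Proof.
have le1 : (\rank (Q p) <= \rank (L p))%N by exact: mxrankM_maxl.
have le2 : (\rank (L p) <= \rank (Q p))%N.
  by rewrite -mxrank_opp -phi2_L mxrankM_maxl.
by apply/eqP; rewrite -[X in _ == X](rank_L p) eqn_leq le1.
Qed.

Lemma rank_E p : \rank (E p) = 1.
Proof.
rewrite genmxE rank_rV; have [xi0|//] := eqVneq (xi p) 0.
by have := ev_xi p; rewrite /ev xi0 mul0mx mxE => /eqP; rewrite eq_sym oner_eq0.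
Qed.

(** The ranks n, n and 1 add up to the dimension of the manifold. *)
Lemma splitting_full p : row_full (L p + (Q p + E p))%MS.
Proof.
have QE : (Q p :&: E p)%MS = 0.
  apply/eqP; rewrite -submx0 -(cap_Q p); apply: capmxS => //; exact: addsmxSr.
rewrite /row_full mxrank_disjoint_sum ?cap_L // mxrank_disjoint_sum //.
by rewrite rank_L rank_Q rank_E addn1 addnS addnn.
Qed.

Lemma app_proj3 (A B C : plane_field R n.*2.+1 M) V p :
  proj3 A B C V p = V p *m proj_mx (A p) (B p + C p)%MS.
Proof. by []. Qed.

Lemma pr_vec p (l q : 'rV[R]_(n.*2.+1)) (c : R) V :
  V p = l + q + c *: xi p -> (l <= L p)%MS -> (q <= Q p)%MS ->
  [/\ pr1 V p = l, pr2 V p = q & pr3 V p = c *: xi p].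
Proof.
move=> Vp lL qQ; have eE : (c *: xi p <= E p)%MS by rewrite scalemx_sub ?genmxE.
rewrite !app_proj3 Vp !mulmxDl; split.
- rewrite (proj_mx_id (cap_L p) lL) !(proj_mx_0 (cap_L p)) ?addr0 //.
    by rewrite (submx_trans eE) ?addsmxSr.
  by rewrite (submx_trans qQ) ?addsmxSl.
- rewrite (proj_mx_id (cap_Q p) qQ) !(proj_mx_0 (cap_Q p)) ?add0r ?addr0 //.
    by rewrite (submx_trans eE) ?addsmxSr.
  by rewrite (submx_trans lL) ?addsmxSl.
- rewrite (proj_mx_id (cap_E p) eE) !(proj_mx_0 (cap_E p)) ?add0r //.
    by rewrite (submx_trans qQ) ?addsmxSr.
  by rewrite (submx_trans lL) ?addsmxSl.
Qed.

Lemma pr_eq V X Y f :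
  V = X + Y + fscale f xi ->
  (forall p, X p <= L p)%MS -> (forall p, Y p <= Q p)%MS ->
  [/\ pr1 V = X, pr2 V = Y & pr3 V = fscale f xi].
Proof.
move=> VE XL YQ.
have H p : [/\ pr1 V p = X p, pr2 V p = Y p & pr3 V p = f p *: xi p].
  by apply: pr_vec (XL p) (YQ p); rewrite VE.
by split; apply/funext => p; have [] := H p.
Qed.

Lemma pr_split V : [/\ V = pr1 V + pr2 V + fscale (ev eta V) xi,
  forall p, (pr1 V p <= L p)%MS, forall p, (pr2 V p <= Q p)%MS
  & pr3 V = fscale (ev eta V) xi].
Proof.
have H p : [/\ V p = pr1 V p + pr2 V p + ev eta V p *: xi p,
    (pr1 V p <= L p)%MS, (pr2 V p <= Q p)%MS & pr3 V p = ev eta V p *: xi p].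
  have /sub_addsmxP[[a b] /= Vab] := submx_full (V p) (splitting_full p).
  have /sub_addsmxP[[c d] /= bcd] := submxMl b (Q p + E p)%MS.
  have [e Ee] := xi_E p.
  pose t := (d *m e) 0 0.
  have dE : d *m E p = t *: xi p.
    by rewrite Ee mulmxA [d *m e]mx11_scalar mul_scalar_mx.
  have VE : V p = a *m L p + c *m Q p + t *: xi p by rewrite Vab bcd dE addrA.
  have [p1 p2 p3] := pr_vec VE (submxMl _ _) (submxMl _ _).
  have tE : ev eta V p = t.
    rewrite /ev VE !mulmxDl -(mulmxA a) -(mulmxA c) L_eta Q_eta !mulmx0 !add0r.
    rewrite -scalemxAl mxE.
    by have := ev_xi p; rewrite /ev => ->; rewrite mulr1.
  by rewrite p1 p2 p3 tE !submxMl.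
split; first by apply/funext => p; have [] := H p.
- by move=> p; have [] := H p.
- by move=> p; have [] := H p.
by apply/funext => p; have [] := H p.
Qed.

Lemma ip_LQ X Y p : (X p <= L p)%MS -> (Y p <= Q p)%MS -> ip g X Y p = 0.
Proof.
move=> /submxP[a Xa] /submxP[b Yb].
rewrite -innerE /inner Xa Yb trmx_mul mulmxA -(mulmxA a) -(mulmxA a).
by rewrite L_orth_Q mulmx0 mul0mx mxE.
Qed.

(** With F the matrix of the frame and G = F g F^T its Gram matrix, the component
    l = a F along L satisfies V g F^T = l g F^T = a G, because V - l is orthogonal
    to L; so a = (V g F^T) G^-1. *)
Lemma pr1_frame (X : 'I_n -> vfield) V q :
  row_free (\matrix_i X i q) -> (\matrix_i X i q :=: L q)%MS ->
  let G := \matrix_(i, j) ip g (X i) (X j) q in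
  G \in unitmx /\
  pr1 V q = \sum_j (\sum_i ip g V (X i) q * invmx G i j) *: X j q.
Proof.
set F := \matrix_i X i q => rF FL G.
have GE : G = F *m g q *m F^T.
  by apply/matrixP => i j; rewrite mulmx_row !rowK mxE -innerE.
have uG : G \in unitmx.
  rewrite -row_free_unit -kermx_eq0; apply/rowV0P => v /sub_kermxP vG.
  have vF : v *m F = 0.
    apply: (@posdef_mx q); rewrite trmx_mul mulmxA -(mulmxA v) -(mulmxA v) -GE.
    by rewrite vG mul0mx.
  by apply: (row_free_inj rF); rewrite vF mul0mx.
split=> //; have [VE lL qQ _] := pr_split V.
have /submxP[a aF] : (pr1 V q <= F)%MS by rewrite FL.
have VXi i : ip g V (X i) q = ip g (pr1 V) (X i) q.
  have XL : (X i q <= L q)%MS by rewrite -FL -(rowK (fun i => X i q)) row_sub.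
  have Xxi : ip g xi (X i) q = 0.
    by rewrite ipC ip_xi /ev; have /submxP[c ->] := XL; rewrite -mulmxA L_eta mulmx0 mxE.
  rewrite {1}VE; move: (pr1 V) (pr2 V) (qQ q) => l w wQ.
  by rewrite !ipDl ipZl Xxi mulr0 addr0 (ipC w) (ip_LQ XL wQ) addr0.
have bE : \row_i ip g V (X i) q = a *m G.
  apply/rowP => i; rewrite mxE VXi -innerE /inner aF GE !mulmxA.
  by rewrite [RHS]mulmx_row row_id rowK.
transitivity (\row_i ip g V (X i) q *m invmx G *m F).
  by rewrite bE mulmxK // aF.
rewrite mulmx_sum_row; apply: eq_bigr => j _; rewrite rowK; congr (_ *: _).
by rewrite mxE; apply: eq_bigr => i _; rewrite mxE.
Qed.

Lemma smooth_pr1 V : smooth V -> smooth (pr1 V).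
Proof.
move=> sV; apply: smooth_field_local => p.
have [X [U [LX oU Up FX]]] := legendrian_frame p; exists U; split => //.
pose G q := \matrix_(i, j) ip g (X i) (X j) q.
have sX i : smooth (X i) by have [] := LX i.
have uG q : U q -> G q \in unitmx.
  by move=> Uq; have [rF FL] := FX q Uq; have [] := pr1_frame V rF FL.
have sG i j : smooth_fun_on S U (fun q => G q i j).
  have -> : (fun q => G q i j) = ip g (X i) (X j) by apply/funext => q; rewrite mxE.
  exact: smooth_funW (smooth_inner (sX i) (sX j)).
pose c j q := \sum_i ip g V (X i) q * invmx (G q) i j.
have sc j : smooth_fun_on S U (c j).
  apply: (smooth_fun_on_sum oU) => i; apply: (smooth_fun_onM oU).
    exact: smooth_funW (smooth_inner sV (sX i)).
  exact: (smooth_invmx_on oU).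
have scX j := smooth_field_onZ oU (sc j) (smooth_fieldW U (sX j)).
apply: (smooth_field_on_eq oU _ (smooth_field_on_sum oU (index_enum _) scX)).
move=> q; rewrite inE => Uq; have [rF FL] := FX q Uq.
by have [_ ->] := pr1_frame V rF FL.
Qed.

Lemma sections_pr1 V : smooth V -> sections S L (pr1 V).
Proof.
by move=> sV; have [_ lL _ _] := pr_split V; split; [exact: smooth_pr1|exact: lL].
Qed.

Lemma sections_pr2 V : smooth V -> sections S Q (pr2 V).
Proof.
move=> sV; have [VE _ qQ _] := pr_split V; split; last exact: qQ.
have -> : pr2 V = V - pr1 V - fscale (ev eta V) xi.
  apply/funext => p.
  have Vp : V p = pr1 V p + pr2 V p + fscale (ev eta V) xi p by rewrite {1}VE.
  by rewrite !fctE Vp addrAC addrK [_ + pr2 V p]addrC addrK.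
apply: smooth_fieldB; last exact: smooth_fscale (smooth_ev sV) smooth_xi.
exact: smooth_fieldB sV (smooth_pr1 sV).
Qed.

Lemma sections_add (B : plane_field R n.*2.+1 M) X Y :
  sections S B X -> sections S B Y -> sections S B (X + Y).
Proof.
move=> [sX XB] [sY YB]; split=> [|p]; first exact: smooth_fieldD sX sY.
exact: addmx_sub (XB p) (YB p).
Qed.

Lemma sections_opp (B : plane_field R n.*2.+1 M) X :
  sections S B X -> sections S B (- X).
Proof.
move=> [sX XB]; split=> [|p]; first exact: smooth_fieldN sX.
by rewrite fctE eqmx_opp; exact: XB.
Qed.

Lemma sections_phiL X : sections S L X -> sections S Q (app phi X).
Proof. by move=> [sX XL]; split=> [|p]; [exact: smooth_app|exact: submxMr]. Qed.

Lemma sections_phiQ Y : sections S Q Y -> sections S L (app phi Y).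
Proof.
move=> [sY YQ]; split=> [|p]; first exact: smooth_app.
by rewrite -(eqmx_opp (L p)) -phi2_L; exact: submxMr.
Qed.

Lemma ev_L X p : sections S L X -> ev eta X p = 0.
Proof.
move=> [_ /(_ p)/submxP[a Xa]].
by rewrite /ev Xa -mulmxA L_eta mulmx0 mxE.
Qed.

Lemma ev_Q X p : sections S Q X -> ev eta X p = 0.
Proof.
move=> [_ /(_ p)/submxP[a Xa]].
by rewrite /ev Xa -mulmxA Q_eta mulmx0 mxE.
Qed.

Lemma ip_sectionsLQ X Y p : sections S L X -> sections S Q Y -> ip g X Y p = 0.
Proof. by move=> [_ XL] [_ YQ]; exact: ip_LQ. Qed.

(** * Consequences of the parallelism of L *)

Section PreservedByTanakaWebster.
Context (presL : forall V X, smooth V -> sections S L X -> sections S L (tw V X)).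

(** In 2 deta(V, Z) = V(eta(Z)) - Z(eta(V)) - eta([V, Z]), differentiate
    eta = g(., xi) by metricity and expand the bracket by the torsion formula: the
    terms in deta cancel. *)
Lemma ip_tw_xi_sym V Z p : smooth V -> smooth Z ->
  ip g (tw V xi) Z p = ip g (tw Z xi) V p.
Proof.
move=> sV sZ.
have evE W : ev eta W = ip g W xi by apply/funext => q; rewrite ip_xi.
have : dform S eta V Z p = dform S eta V Z p by [].
rewrite {1}/dform -br_def 2!evE (tw_metric _ sV sZ smooth_xi).
rewrite (tw_metric _ sZ sV smooth_xi) -(ip_xi (br V Z)) (tw_torsion sV sZ).
rewrite ipDl ipDl 2!ipNl ipZl (ip_xi xi) ev_xi mulr1 (ipC Z) (ipC V).
move: (ip g (tw V Z) xi p) (ip g (tw Z V) xi p) (dform S eta V Z p) => a b c.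
move: (ip g (tw V xi) Z p) (ip g (tw Z xi) V p) => d e E; lra.
Qed.

Lemma ip_tw_xi_xi V p : smooth V -> ip g (tw V xi) xi p = 0.
Proof.
move=> sV; have := tw_metric p sV smooth_xi smooth_xi.
have -> : ip g xi xi = cst 1 by apply/funext => q; rewrite ip_xi ev_xi.
rewrite dird_cst (ipC xi); move: (ip g _ _ p) => x E; rewrite /= in E; lra.
Qed.

(** This is where the parallelism of L enters: eta(tw V X) = 0. *)
Lemma ip_tw_xi_L V X p : smooth V -> sections S L X -> ip g (tw V xi) X p = 0.
Proof.
move=> sV LX; have [sX _] := LX; have := tw_metric p sV sX smooth_xi.
have -> : ip g X xi = cst 0 by apply/funext => q; rewrite ip_xi ev_L.
by rewrite dird_cst ip_xi (ev_L _ (presL sV LX)) add0r ipC.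
Qed.

Lemma lie_xi_phi V : smooth V -> br xi (app phi V) = app phi (br xi V).
Proof.
move=> sV; apply/subr0_eq/funext => p.
have := congr1 (fun U => 2 *: U p) (h_tensor0 sV).
by rewrite /h_tensor br_def scalerA divff ?scale1r ?scaler0 // pnatr_eq0.
Qed.

(* on fields of ker eta, the Lie derivative of g along xi *)
Let killing V W p := ip g (tw V xi) W p + ip g V (tw W xi) p.

Let killingE V W p : smooth V -> smooth W ->
  (forall q, ev eta V q = 0) -> (forall q, ev eta W q = 0) ->
  killing V W p = dird S xi (ip g V W : M -> R^o) p
    - ip g (br xi V) W p - ip g V (br xi W) p.
Proof.
move=> sV sW V0 W0; rewrite (ipC V (br _ _)) (tw_metric _ smooth_xi sV sW).
rewrite (ip_bracket smooth_xi sV (W0 p)) (ip_bracket smooth_xi sW (V0 p)) /killing.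
rewrite (ipC V (tw W xi)) (ipC V (tw xi W)).
by ring.
Qed.

Let killing_phi V W p : smooth V -> smooth W ->
  (forall q, ev eta V q = 0) -> (forall q, ev eta W q = 0) ->
  killing (app phi V) (app phi W) p = killing V W p.
Proof.
move=> sV sW V0 W0; have [sfV sfW] := (smooth_app sV, smooth_app sW).
rewrite (killingE _ sfV sfW (ev_phi V) (ev_phi W)) (killingE _ sV sW V0 W0).
have sxV := smooth_bracket smooth_xi sV; have sxW := smooth_bracket smooth_xi sW.
rewrite (lie_xi_phi sV) (lie_xi_phi sW).
rewrite (ip_phi2 _ sxV sW) (ip_phi2 _ sV sxW) V0 W0 mulr0 mul0r 2!subr0.
have -> // : ip g (app phi V) (app phi W) = ip g V W.
by apply/funext => q; rewrite (ip_phi2 _ sV sW) V0 mul0r subr0.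
Qed.

(** By invariance under phi the Lie derivative of g vanishes on Q because it does
    on L; by symmetry it is twice g(tw Y xi, Y'). *)
Lemma ip_tw_xi_Q Y Y' p :
  sections S Q Y -> sections S Q Y' -> ip g (tw Y xi) Y' p = 0.
Proof.
move=> QY QY'; have [[sY _] [sY' _]] := (QY, QY').
have [LX LX'] := (sections_phiQ QY, sections_phiQ QY').
have [sX sX'] := (smooth_app sY, smooth_app sY').
have : killing Y Y' p = 0.
  have [Y0 Y'0] := (fun q => ev_Q q QY, fun q => ev_Q q QY').
  rewrite -(killing_phi p sY sY' Y0 Y'0).
  by rewrite /killing (ip_tw_xi_L _ sX LX') ipC (ip_tw_xi_L _ sX' LX) addr0.
rewrite /killing (ipC Y) (ip_tw_xi_sym p sY' sY).
by move: (ip g _ _ p) => x E; lra.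
Qed.

(** U = tw V xi lies in Q, so g(U, U) = g(tw U xi, V) by symmetry, where again only
    the component of V along Q counts. *)
Lemma tw_xi V : smooth V -> tw V xi = 0.
Proof.
move=> sV; have sU := smooth_tw sV smooth_xi; pose U := tw V xi.
have [LX QY] := (sections_pr1 sU, sections_pr2 sU).
have [UE _ _ _] := pr_split U.
have [VE _ _ _] := pr_split V.
have [LV QV] := (sections_pr1 sV, sections_pr2 sV).
have [sY _] := QY.
apply/funext => p; apply: (@ip_eq0 U p).
have -> : ip g U U p = ip g U (pr1 U + pr2 U + fscale (ev eta U) xi) p.
  by rewrite -UE.
rewrite 2!ipDr ipZr (ip_tw_xi_L _ sV LX) (ip_tw_xi_xi _ sV) mulr0 add0r addr0.
rewrite (ip_tw_xi_sym _ sV sY).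
have -> : ip g (tw (pr2 U) xi) V p =
    ip g (tw (pr2 U) xi) (pr1 V + pr2 V + fscale (ev eta V) xi) p.
  by rewrite -VE.
rewrite 2!ipDr ipZr (ip_tw_xi_L _ sY LV) (ip_tw_xi_xi _ sY) mulr0 add0r addr0.
exact: ip_tw_xi_Q.
Qed.

(** The components of tw V Y along xi and L vanish by metricity, xi and L being
    parallel and orthogonal to Q. *)
Lemma presQ V Y : smooth V -> sections S Q Y -> sections S Q (tw V Y).
Proof.
move=> sV QY; have [sY _] := QY; have sU := smooth_tw sV sY; pose U := tw V Y.
have [UE _ _ _] := pr_split U; have LX := sections_pr1 sU.
have QU := sections_pr2 sU; have [sX _] := LX.
suff -> : tw V Y = pr2 U by [].
have U0 : ev eta U = cst 0.
  apply/funext => p; have := tw_metric p sV sY smooth_xi.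
  have -> : ip g Y xi = cst 0 by apply/funext => q; rewrite ip_xi ev_Q.
  by rewrite dird_cst ip_xi (tw_xi sV) ipC ip0l addr0 => /esym.
have X0 : pr1 U = 0.
  apply/funext => p; apply: (@ip_eq0 (pr1 U) p).
  have := tw_metric p sV sY sX.
  have -> : ip g Y (pr1 U) = cst 0.
    by apply/funext => q; rewrite ipC (ip_sectionsLQ _ LX QY).
  rewrite dird_cst (ipC Y) (ip_sectionsLQ _ (presL sV LX) QY) addr0 -/U.
  have -> : ip g U (pr1 U) p =
      ip g (pr1 U + pr2 U + fscale (ev eta U) xi) (pr1 U) p by rewrite -UE.
  rewrite 2!ipDl ipZl U0 mul0r addr0 (ipC (pr2 U)) (ip_sectionsLQ _ LX QU) addr0.
  by move=> <-.
rewrite -/U {1}UE X0 U0; apply/funext => p.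
by rewrite !fctE fscaleE scale0r add0r addr0.
Qed.

Lemma parallel_L : parallel_legendrian (sections S L).
Proof.
split=> [X []//|X p|X Y p|X Y|X|]; first exact: ev_L; last 3 first.
- exact: sections_add.
- exact: sections_opp.
- exact: presL.
by case: leg => _ _; apply.
Qed.

Lemma parallel_Q : parallel_legendrian (sections S Q).
Proof.
split=> [X []//|X p|X Y p QX QY|X Y|X|]; first exact: ev_Q; last 3 first.
- exact: sections_add.
- exact: sections_opp.
- exact: presQ.
have [[sX _] [sY _]] := (QX, QY); rewrite -(dform_phi _ sX sY).
by case: leg => _ _; apply; exact: sections_phiQ.
Qed.

(** * Comparison with the bi-Legendrian connection *)

Lemma bracket_tw V W : smooth V -> smooth W ->
  br V W = tw V W + - tw W V + fscale (fun p => - (2 * dform S eta V W p)) xi.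
Proof.
move=> sV sW; rewrite (tw_torsion sV sW); apply/funext => p.
by rewrite !fctE !fscaleE scaleNr.
Qed.

Lemma tw_fscale_xi f V : smooth_fun S f -> smooth V ->
  tw V (fscale f xi) = fscale (dird S V (f : M -> R^o)) xi.
Proof.
move=> sf sV; rewrite (tw_scaler sf sV smooth_xi) (tw_xi sV) -[RHS]addr0.
by congr (_ + _); apply/funext => p; rewrite fscaleE scaler0.
Qed.

Lemma fscaleD f h V : fscale f V + fscale h V = fscale (fun p => f p + h p) V.
Proof. by apply/funext => p; rewrite fctE !fscaleE scalerDl. Qed.

Let sub0 (B : plane_field R n.*2.+1 M) p : ((0 : vfield) p <= B p)%MS.
Proof. exact: sub0mx. Qed.

Lemma pr1_bracket_Q Y X : sections S Q Y -> sections S L X ->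
  pr1 (br Y X) = tw Y X.
Proof.
move=> QY LX; have [[sY _] [sX _]] := (QY, LX).
have [_ DL] := presL sY LX; have [_ DQ] := sections_opp (presQ sX QY).
by have [-> _ _] := pr_eq (bracket_tw sY sX) DL DQ.
Qed.

Lemma pr2_bracket_L X Y : sections S L X -> sections S Q Y ->
  pr2 (br X Y) = tw X Y.
Proof.
move=> LX QY; have [[sY _] [sX _]] := (QY, LX).
have [_ DQ] := presQ sX QY; have [_ DL] := sections_opp (presL sY LX).
have := bracket_tw sX sY; rewrite [tw X Y + _]addrC => E.
by have [_ -> _] := pr_eq E DL DQ.
Qed.

Lemma bracket_fscale_xi f W : smooth_fun S f -> smooth W ->
  exists h, br (fscale f xi) W = tw (fscale f xi) W + fscale h xi.
Proof.
move=> sf sW; have sfx := smooth_fscale sf smooth_xi.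
exists (fun p => - dird S W (f : M -> R^o) p
                 + - (2 * dform S eta (fscale f xi) W p)).
rewrite (bracket_tw sfx sW) (tw_fscale_xi sf sW) -fscaleD addrA; congr (_ + _ + _).
by apply/funext => p; rewrite fctE !fscaleE scaleNr.
Qed.

Lemma pr1_bracket_xi f X : smooth_fun S f -> sections S L X ->
  pr1 (br (fscale f xi) X) = tw (fscale f xi) X.
Proof.
move=> sf LX; have [sX _] := LX; have sfx := smooth_fscale sf smooth_xi.
have [h E] := bracket_fscale_xi sf sX; rewrite -[tw _ X]addr0 in E.
by have [_ DL] := presL sfx LX; have [-> _ _] := pr_eq E DL (sub0 _).
Qed.

Lemma pr2_bracket_xi f Y : smooth_fun S f -> sections S Q Y ->
  pr2 (br (fscale f xi) Y) = tw (fscale f xi) Y.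
Proof.
move=> sf QY; have [sY _] := QY; have sfx := smooth_fscale sf smooth_xi.
have [h E] := bracket_fscale_xi sf sY; rewrite -[tw _ Y]add0r in E.
by have [_ DQ] := presQ sfx QY; have [_ -> _] := pr_eq E (sub0 _) DQ.
Qed.

Lemma pr1_L X : sections S L X -> pr1 X = X.
Proof.
move=> [_ XL]; have E : X = X + 0 + fscale (cst 0) xi.
  by rewrite addr0 -[LHS]addr0; congr (_ + _); apply/funext => p; rewrite fscaleE scale0r.
by have [] := pr_eq E XL (sub0 _).
Qed.

Lemma pr2_Q Y : sections S Q Y -> pr2 Y = Y.
Proof.
move=> [_ YQ]; have E : Y = 0 + Y + fscale (cst 0) xi.
  by rewrite add0r -[LHS]addr0; congr (_ + _); apply/funext => p; rewrite fscaleE scale0r.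
by have [] := pr_eq E (sub0 _) YQ.
Qed.

(** The terms obtained by splitting V and W match those of the definition: the
    derivatives along the distribution itself through H, the others through
    projected brackets, and those of eta(W) xi because xi is parallel. *)
Lemma tw_bileg V W : smooth V -> smooth W -> tw V W = bileg S eta xi L Q V W.
Proof.
move=> sV sW; rewrite /bileg -br_def.
have [VE _ _ V3] := pr_split V; have [WE _ _ _] := pr_split W.
have [LV QV] := (sections_pr1 sV, sections_pr2 sV).
have [LX QY] := (sections_pr1 sW, sections_pr2 sW).
have [[sV1 _] [sV2 _]] := (LV, QV); have [[sX _] [sY _]] := (LX, QY).
have sf := smooth_ev sV; have sh := smooth_ev sW.
have [sfx shx] := (smooth_fscale sf smooth_xi, smooth_fscale sh smooth_xi).
have [PL PQ] := (parallel_L, parallel_Q).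
rewrite V3 (bileg_H_tw PL PQ sections_phiL sections_phiQ LV LX).
rewrite (bileg_H_tw PQ PL sections_phiQ sections_phiL QV QY).
rewrite (pr1_L (presL sV1 LX)) (pr2_Q (presQ sV2 QY)).
rewrite (pr1_bracket_Q QV LX) (pr2_bracket_L LV QY).
rewrite (pr1_bracket_xi sf LX) (pr2_bracket_xi sf QY) -(tw_fscale_xi sh sV).
have DV U : smooth U ->
    tw V U = tw (pr1 V) U + tw (pr2 V) U + tw (fscale (ev eta V) xi) U.
  move=> sU; rewrite {1}VE (twDl (smooth_fieldD sV1 sV2) sfx sU).
  by rewrite (twDl sV1 sV2 sU).
rewrite {1}WE (twDr sV (smooth_fieldD sX sY) shx) (twDr sV sX sY).
rewrite (DV _ sX) (DV _ sY); congr (_ + _ + _).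
by rewrite [tw (pr1 V) (pr2 W) + _]addrC.
Qed.

End PreservedByTanakaWebster.

End LegendrianSplitting.

End Connection.
End ContactMetric.

Theorem theorem3p7 (R : realType) (n : nat) (M : topologicalType)
    (S : manifold R n.*2.+1 M)
    (phi : endo R n.*2.+1 M) (xi : vfield R n.*2.+1 M)
    (eta : form1 R n.*2.+1 M) (g : endo R n.*2.+1 M)
    (nabla : vfield R n.*2.+1 M -> vfield R n.*2.+1 M -> vfield R n.*2.+1 M)
    (L : plane_field R n.*2.+1 M) :
  sasakian S phi xi eta g ->
  levi_civita S g nabla ->
  legendrian S eta L ->
  flat_distr S xi L ->
  (forall V X, smooth_field S V -> sections S L X ->
     sections S L (tanaka_webster S phi xi eta nabla V X)) ->
  [/\ integrable_distr S L,
      integrable_distr S (conj_distr phi L)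
    & forall V W, smooth_field S V -> smooth_field S W ->
        tanaka_webster S phi xi eta nabla V W =
        bileg S eta xi L (conj_distr phi L) V W].
Proof.
move=> [cm nij] lc leg _ presL.
have tw_def := erefl (tanaka_webster S phi xi eta nabla).
have br_def := erefl (bracket S).
split=> [X Y|X Y|V W].
- exact: (parallel_legendrian_bracket cm lc nij tw_def br_def (parallel_L leg presL)).
- have PQ := parallel_Q cm lc nij tw_def br_def leg presL.
  exact: (parallel_legendrian_bracket cm lc nij tw_def br_def PQ).
- exact: (tw_bileg cm lc nij tw_def br_def leg presL).
Qed.
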